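(* Let $G$ be a countable amenable group which does not admit any ICC quotient group. Then every right Følner sequence in $G$ is a firm strong sequence in $G$. In particular, the Left Strong Ergodic Theorem holds for every countable virtually nilpotent group.
   Context: A non-trivial countable group is ICC if every non-trivial element has an infinite conjugacy class (the trivial group is not counted as ICC). A group is virtually nilpotent if it contains a nilpotent subgroup of finite index. A sequence $(F_n)$ of (nonempty) finite subsets of $G$ is a right Følner sequence if $\lim_n |F_n\triangle F_nt|/|F_n|=0$ for all $t\in G$, and a left Følner sequence if $\lim_n|F_n\triangle tF_n|/|F_n|=0$ for all $t\in G$. For a unitary representation $(\mathcal{H},\pi)$ of $G$, $P_G$ denotes the orthogonal projection onto the closed subspace of $\pi(G)$-invariant vectors. A sequence $(K_m)$ of finite subsets of $G$ is a firm strong sequence in $G$ if for every unitary representation $(\mathcal{H},\pi)$ of $G$, every sequence $(t_m)$ in $G$ and every $v\in\mathcal{H}$, $\lim_m\frac{1}{|K_m|}\sum_{t\in K_m}\pi(tt_m)v=P_Gv$ in norm. The Left Strong Ergodic Theorem holds for a countable amenable group $G$ if for every unitary representation $(\mathcal{H},\pi)$ of $G$, every left Følner sequence $(F_n)$ in $G$ and every $v\in\mathcal{H}$, $\lim_n\frac{1}{|F_n|}\sum_{s\in F_n}\pi(s)v=P_Gv$ in norm. *)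

(* Defs.v *)
From HB Require Import structures.
From mathcomp Require Import all_boot all_order all_algebra finmap.
From mathcomp Require Import complex.
From mathcomp Require Import all_classical all_reals all_analysis.

Set Implicit Arguments.
Unset Strict Implicit.
Unset Printing Implicit Defensive.

Import Order.TTheory GRing.Theory Num.Theory Num.Def.
Import numFieldNormedType.Exports.

Local Open Scope classical_set_scope.
Local Open Scope ring_scope.

Definition ICC (G : groupType) : Prop :=
  (exists x : G, x != 1%g) /\
  (forall x : G, x != 1%g -> infinite_set [set (x ^ y)%g | y in [set: G]]).

(* A quotient group of G is presented as the target of a surjective
   homomorphism defined on G. *)
Definition admits_ICC_quotient (G : groupType) : Prop :=
  exists (Q : groupType) (f : {multiplicative G -> Q}),
    set_surj [set: G] [set: Q] f /\ ICC Q.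

Section Subgroups.
Variable G : groupType.
Implicit Types A H : set G.

Definition subgroup H : Prop :=
  H 1%g /\ (forall x y, H x -> H y -> H (x * y^-1)%g).

Definition generated A : set G := smallest subgroup A.

Fixpoint lower_central H (n : nat) : set G :=
  if n is n'.+1 then
    generated [set [~ x, y]%g | x in lower_central H n' & y in H]
  else H.

Definition nilpotent_subgroup H : Prop :=
  subgroup H /\ exists n, lower_central H n = [set 1%g].

Definition left_cosets H : set (set G) :=
  [set [set (x * h)%g | h in H] | x in [set: G]].

Definition virtually_nilpotent : Prop :=
  exists H, nilpotent_subgroup H /\ finite_set (left_cosets H).

End Subgroups.

(* Von Neumann's definition: G carries a left-invariant finitely additive
   probability measure defined on all its subsets. *)
Definition amenable (R : realType) (G : groupType) : Prop :=
  exists mu : set G -> R,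
    [/\ forall A, 0 <= mu A,
        mu [set: G] = 1,
        forall A B, A `&` B = set0 -> mu (A `|` B) = mu A + mu B &
        forall (t : G) A, mu [set (t * x)%g | x in A] = mu A].

Section Folner.
Variables (R : realType) (G : groupType).
Implicit Types (A B : {fset G}) (F : nat -> {fset G}).

Definition fsym_diff A B : {fset G} := ((A `\` B) `|` (B `\` A))%fset.

Definition rtranslate A (t : G) : {fset G} := [fset (x * t)%g | x in A]%fset.

Definition ltranslate (t : G) A : {fset G} := [fset (t * x)%g | x in A]%fset.

Definition right_Folner F : Prop :=
  (forall n, F n != fset0) /\
  (forall t : G,
     (#|` fsym_diff (F n) (rtranslate (F n) t)|%:R / #|` F n|%:R : R)
       @[n --> \oo] --> (0 : R)).

Definition left_Folner F : Prop :=
  (forall n, F n != fset0) /\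
  (forall t : G,
     (#|` fsym_diff (F n) (ltranslate t (F n))|%:R / #|` F n|%:R : R)
       @[n --> \oo] --> (0 : R)).

End Folner.

(* A complex Hilbert space is a complete normed space H over R[i] with an inner
   product (linear in its first argument) that induces the norm of H. *)
Definition induces_norm (R : realType) (H : completeNormedModType R[i])
    (dot : {dot H for conjC}) : Prop :=
  forall u : H, dot u u = `|u| ^+ 2.

Section Representations.
Variables (R : realType) (G : groupType) (H : completeNormedModType R[i]).
Variable dot : {dot H for conjC}.
Implicit Types (pi : G -> {linear H -> H}) (v w : H) (W : set H).

Definition unitary_operator (T : {linear H -> H}) : Prop :=
  bijective T /\ isometry dot dot T.

Definition unitary_representation pi : Prop :=
  [/\ forall s, unitary_operator (pi s),
      forall v, pi 1%g v = v &
      forall s t v, pi (s * t)%g v = pi s (pi t v)].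

(* The default value of [get] is never used when W is a closed subspace. *)
Definition orthogonal_projection W v : H :=
  get [set w | W w /\ forall u, W u -> dot (v - w) u = 0].

Definition invariant_vectors pi : set H := [set v | forall s, pi s v = v].

Definition P_inv pi v : H := orthogonal_projection (invariant_vectors pi) v.

End Representations.

Definition firm_strong (R : realType) (G : groupType)
    (K : nat -> {fset G}) : Prop :=
  forall (H : completeNormedModType R[i]) (dot : {dot H for conjC})
         (pi : G -> {linear H -> H}),
    induces_norm dot -> unitary_representation dot pi ->
  forall (t_ : nat -> G) (v : H),
    ((#|` K m|%:R : R[i])^-1 *: \sum_(t <- K m) pi (t * t_ m)%g v)
      @[m --> \oo] --> P_inv dot pi v.

Definition left_strong_ergodic_theorem (R : realType) (G : groupType) : Prop :=
  forall (H : completeNormedModType R[i]) (dot : {dot H for conjC})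
         (pi : G -> {linear H -> H}),
    induces_norm dot -> unitary_representation dot pi ->
  forall F : nat -> {fset G}, left_Folner R F ->
  forall v : H,
    ((#|` F n|%:R : R[i])^-1 *: \sum_(s <- F n) pi s v)
      @[n --> \oo] --> P_inv dot pi v.

(* Main.v *)
(**
Let [F] be right Folner, and let [V] be the closed invariant subspace of the
vectors [v] such that the means of [s |-> pi (s t) v] over [F n] tend to [0]
uniformly in [t]. The elements [x] such that [pi x u - u] is in [V] for all [u]
form a normal subgroup [N], which acts trivially on the orthogonal complement
of [V]. If [x] has finitely many conjugates modulo [N], then for [q] orthogonal
to [V] one has [pi (t x) q = pi (c t) q] with [c] in a finite set independent of
[t], and the Folner condition gives [pi x q - q] in [V]; hence [x] is in [N].
So [G / N] has no nontrivial finite conjugacy class, and in the absence of ICC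
quotients [N = G]: the complement of [V] consists of invariant vectors.

For a left Folner [F], apply this to the inverses [K n] of the sets [F n]. The
operators [A n] and [B n] of mean over [K n] and [F n] are adjoint, so that for
[p] in [V], [`|B n p|^2 = dot p (A n (B n p))], where [A n (B n p)] is a mean of
the vectors [A n (pi s p)], which are uniformly small.

If [G] is virtually nilpotent, with [H] nilpotent of finite index, consider in a
quotient of [G] the last nontrivial image of a term of the lower central series
of [H]: it centralizes the image of [H], so its elements have finitely many
conjugates. If there is none, the quotient is finite.
*)
Require Import Defs.
From HB Require Import structures.
From mathcomp Require Import all_boot all_order all_algebra finmap.
From mathcomp Require Import complex ring.
From mathcomp Require Import all_classical all_reals all_analysis.

Set Implicit Arguments.
Unset Strict Implicit.
Unset Printing Implicit Defensive.

Import Order.TTheory GRing.Theory Num.Theory Num.Def.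
Import numFieldNormedType.Exports.

Local Open Scope classical_set_scope.
Local Open Scope ring_scope.

(** * ICC quotients *)

Section QuotientGroup.
Variables (G : groupType) (N : set G).
Hypotheses (subgroupN : subgroup N) (normalN : forall x y, N x -> N (x ^ y)%g).

Let N1 : N 1%g. Proof. by case: subgroupN. Qed.
Let NV x : N x -> N x^-1%g.
Proof. by move=> Nx; rewrite -[x^-1%g]mul1g; apply: subgroupN.2. Qed.
Let NM x y : N x -> N y -> N (x * y)%g.
Proof. by move=> Nx Ny; rewrite -[y]invgK; apply/subgroupN.2/NV. Qed.

Definition eqmodN : rel G := fun x y => `[< N (x * y^-1)%g >].

Lemma eqmodN_refl : reflexive eqmodN.
Proof. by move=> x; apply/asboolP; rewrite mulgV. Qed.

Lemma eqmodN_sym : symmetric eqmodN.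
Proof.
by move=> x y; apply/asboolP/asboolP => /NV; rewrite invgM invgK.
Qed.

Lemma eqmodN_trans : transitive eqmodN.
Proof.
move=> y x z /asboolP Nxy /asboolP Nyz; apply/asboolP.
by rewrite -[x](mulgVK y) -mulgA; apply: NM.
Qed.

Canonical eqmodN_equiv := EquivRel eqmodN eqmodN_refl eqmodN_sym eqmodN_trans.

Definition quotient_group := {eq_quot eqmodN}%qT.
HB.instance Definition _ := Choice.on quotient_group.
HB.instance Definition _ := EqQuotient.on quotient_group.

Local Notation Q := quotient_group.
Let proj (x : G) : Q := (\pi_Q x)%qT.

Let projP x y : proj x = proj y <-> N (x * y^-1)%g.
Proof. by split=> [/eqquotP/asboolP //|Nxy]; apply/eqquotP/asboolP. Qed.

Let repr_proj x : N (repr (proj x) * x^-1)%g.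
Proof. by apply/projP; rewrite /proj reprK. Qed.

Definition quotient_mul (a b : Q) : Q := proj (repr a * repr b)%g.
Definition quotient_inv (a : Q) : Q := proj (repr a)^-1%g.

Let proj_mul x y : quotient_mul (proj x) (proj y) = proj (x * y)%g.
Proof.
apply/projP; set x' := repr _; set y' := repr _.
(* Normality keeps [y' * y^-1] in [N] when [x'] is moved across it. *)
have -> : (x' * y' * (x * y)^-1 = (y' * y^-1) ^ x'^-1 * (x' * x^-1))%g.
  by rewrite conjgE invgK invgM !mulgA mulgVK.
by apply: NM; [apply: normalN|]; apply: repr_proj.
Qed.

Let proj_inv x : quotient_inv (proj x) = proj x^-1%g.
Proof.
apply/projP; set x' := repr _.
have -> : (x'^-1 * x^-1^-1 = ((x' * x^-1)^-1) ^ x')%g.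
  by rewrite conjgE invgM !invgK mulgVK.
by apply/normalN/NV/repr_proj.
Qed.

Let projW (P : Q -> Prop) : (forall x, P (proj x)) -> forall a, P a.
Proof. by move=> Pproj a; rewrite -[a]reprK; apply: Pproj. Qed.

Let mulqA : associative quotient_mul.
Proof.
apply: projW => x; apply: projW => y; apply: projW => z.
by rewrite !proj_mul mulgA.
Qed.
Let mul1q : left_id (proj 1%g) quotient_mul.
Proof. by apply: projW => x; rewrite proj_mul mul1g. Qed.
Let mulq1 : right_id (proj 1%g) quotient_mul.
Proof. by apply: projW => x; rewrite proj_mul mulg1. Qed.
Let mulVq : left_inverse (proj 1%g) quotient_inv quotient_mul.
Proof. by apply: projW => x; rewrite proj_inv proj_mul mulVg. Qed.
Let mulqV : right_inverse (proj 1%g) quotient_inv quotient_mul.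
Proof. by apply: projW => x; rewrite proj_inv proj_mul mulgV. Qed.

HB.instance Definition _ := isGroup.Build Q mulqA mul1q mulq1 mulVq mulqV.
HB.instance Definition _ := isMultiplicative.Build G Q proj
  (fun x y => esym (proj_mul x y)).

(* The hypothesis on finite classes says that [G / N] is trivial or ICC. *)
Lemma no_ICC_quotient_full :
    ~ admits_ICC_quotient G ->
    (forall x, (exists s : seq G,
       forall y, exists2 c, c \in s & N ((x ^ y) * c^-1)%g) -> N x) ->
  forall x, N x.
Proof.
move=> noICC fcN x0; apply: contrapT => Nx0; apply: noICC.
have proj1 x : proj x = 1%g <-> N x.
  by rewrite -[1%g]/(proj 1%g) projP invg1 mulg1.
exists Q, proj; split; first by apply: projW => x _; exists x.
split; first by exists (proj x0); apply/eqP => /proj1.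
apply: projW => x /eqP nx1 /finite_seqP[s sE].
(* Representatives of the finite class of [proj x] serve as the list of conjugates of [x] modulo
   [N]. *)
apply: nx1; apply/proj1/fcN; exists [seq repr a | a <- s] => y.
have ys : proj (x ^ y)%g \in s.
  have : [set` s] (proj (x ^ y)%g); last by [].
  rewrite -sE; exists (proj y) => //.
  by rewrite [in RHS]conjgE -!proj_mul -proj_inv.
exists (repr (proj (x ^ y)%g)); first exact: map_f.
by apply/projP; rewrite /proj reprK.
Qed.
End QuotientGroup.

Lemma virtually_nilpotent_no_ICC_quotient (G : groupType) :
  virtually_nilpotent G -> ~ admits_ICC_quotient G.
Proof.
move=> [H [[subH [n LnE]] finH]] [Q [f [fsurj [[q q1] QICC]]]].
have fM x y : f (x * y)%g = (f x * f y)%g by apply: gmulfM.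
have f1 : f 1%g = 1%g by apply: (@mulgI _ (f 1%g)); rewrite -fM !mulg1.
have fV x : f x^-1%g = (f x)^-1%g.
  by apply: (@mulgI _ (f x)); rewrite -fM !mulgV.
(* A class of conjugates by [f g] only depends on the coset [g^-1 H]. *)
have fin_class (x : Q) :
    (forall h, H h -> (x ^ f h)%g = x) \/ (forall h, H h -> f h = 1%g) ->
    finite_set [set (x ^ y)%g | y in [set: Q]].
  move=> Hx.
  have /sub_finite_set : [set (x ^ y)%g | y in [set: Q]] `<=`
      [set (x ^ (f (xget 1%g A))^-1)%g | A in left_cosets H].
    move=> _ [y _ <-]; have [g _ <-] := fsurj y I.
    exists [set (g^-1 * h)%g | h in H]; first by exists g^-1%g.
    set A := [set _ | _ in _].
    (* [A] is nonempty, so [xget] returns an actual element [g^-1 * h] and not its default;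
       conjugating by the inverse of its image is conjugating by [f h^-1], then by [f g]. *)
    have : A (xget 1%g A).
      by apply: (@xgetI _ _ _ (g^-1 * 1)%g); exists 1%g => //; apply: subH.1.
    move=> [h Hh <-]; rewrite -fV invgM invgK fM conjgM.
    have HV : H h^-1%g.
      by rewrite -[(h^-1)%g]mul1g; apply: subH.2 => //; apply: subH.1.
    by case: Hx => Hx; rewrite Hx // ?conjg1.
  by apply; apply: finite_image.
have [Hf|] := pselect (forall h, H h -> f h = 1%g).
  by apply: (QICC q q1); apply: fin_class; right.
move=> H0; suff : forall k, exists2 x, lower_central H k x & f x <> 1%g.
  by move=> /(_ n)[x]; rewrite LnE => -> /(_ f1).
elim=> [|k [x Lx fx]].
  apply: contrapT => nex; apply: H0 => h Hh; apply: contrapT => fh.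
  by apply: nex; exists h.
(* If [f] kills the next term, it kills every [[~ x, h]], so [f x] commutes with the image of [H]
   and has a finite class. *)
apply: contrapT => nex; apply: (QICC (f x)); first exact/eqP.
apply: fin_class; left => h Hh; apply/eqP; rewrite conjg_fix; apply/eqP.
have -> : [~ f x, f h]%g = f [~ x, h]%g by rewrite !commgEl !conjgE !fM !fV.
apply: contrapT => fc; apply: nex; exists [~ x, h]%g => //.
by apply: sub_gen_smallest; exists x => //; exists h.
Qed.

(** * Orthogonal projections in Hilbert spaces *)

Local Open Scope complex_scope.

(** Comparable complex numbers have equal imaginary parts, so a positive one is real; this carries
    each epsilon over to [R]. *)
Lemma gt0_complexE (R : rcfType) (e : R[i]) :
  0 < e -> exists2 r : R, 0 < r & e = r%:C.
Proof.
move=> e0; have eE : (complex.Re e)%:C = e by apply/RRe_real/gtr0_real.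
by exists (complex.Re e) => //; rewrite -ltcR eE.
Qed.

(** If [a] were nonzero, [e = |a| / (b + 1)] would give [b + 1 <= b]. *)
Lemma small_eq0 (C : numFieldType) (a b : C) :
  0 <= b -> (forall e, 0 < e -> `|a| <= e * b) -> a = 0.
Proof.
move=> b0 ab; apply/eqP; apply: contraT => a0.
have b1 : 0 < b + 1 by rewrite ltr_wpDl.
have := ab (`|a| / (b + 1)); rewrite divr_gt0 ?normr_gt0// => /(_ isT).
rewrite mulrAC ler_pdivlMr// ler_pM2l ?normr_gt0//.
by rewrite gerDl ler10.
Qed.

Section Hilbert.
Variables (R : realType) (H : completeNormedModType R[i]).
Variable dot : {dot H for conjC}.
Hypothesis norm_dot : induces_norm dot.
Implicit Types (u v w : H) (V : set H).

Lemma pythagoras u v :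
  dot u v = 0 -> `|u + v| ^+ 2 = `|u| ^+ 2 + `|v| ^+ 2.
Proof. by move=> uv0; rewrite -!norm_dot; apply: hnormDd. Qed.

Lemma parallelogram u v :
  `|u + v| ^+ 2 + `|u - v| ^+ 2 = (`|u| ^+ 2 + `|v| ^+ 2) *+ 2.
Proof.
rewrite -!norm_dot mulr2n linearDl linearBl !linearDr !linearNr/=.
by ring.
Qed.

(** Here [a *: v] is the projection of [u] on the line of [v]. Dropping the first square gives
    Cauchy-Schwarz; bounding it below by a squared distance gives almost orthogonality. *)
Lemma orthogonal_split u v : v != 0 ->
  exists2 a, dot u v = a * `|v| * `|v|
    & `|u| ^+ 2 = `|u - a *: v| ^+ 2 + `|a * `|v| | ^+ 2.
Proof.
move=> v0; have dv0 : dot v v != 0 by rewrite norm_dot sqrf_eq0 normr_eq0.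
set a := dot u v / dot v v.
have orth : dot (u - a *: v) v = 0.
  by rewrite linearBl linearZl_LR/= divfK ?subrr.
exists a; first by rewrite -mulrA -expr2 -norm_dot divfK.
rewrite -[u in LHS](subrK (a *: v)) [LHS]pythagoras; last first.
  by rewrite linearZr_LR/= orth mulr0.
by rewrite normrM normr_id normrZ.
Qed.

Lemma cauchy_schwarz u v : `|dot u v| <= `|u| * `|v|.
Proof.
have [->|/(orthogonal_split u)] := eqVneq v 0.
  by rewrite linear0r !normr0 mulr0.
move=> [a -> uE]; rewrite normrM normr_id ler_wpM2r//.
by rewrite -(@ler_pXn2r _ 2) ?nnegrE// uE lerDr exprn_ge0.
Qed.

Definition closed_subspace V :=
  [/\ V 0, forall a u v, V u -> V v -> V (a *: u + v) & closed V].

(** The infimum of the squared distances is taken over their real parts, as the order of [R[i]] is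
    only partial. *)
Lemma exists_sqdist V v : V !=set0 ->
  exists2 d : R[i], forall w, V w -> d <= `|v - w| ^+ 2 &
    forall e, 0 < e -> exists2 w, V w & `|v - w| ^+ 2 < d + e.
Proof.
move=> V0; pose E := [set complex.Re (`|v - w| ^+ 2) | w in V].
have ReE w : (complex.Re (`|v - w| ^+ 2))%:C = `|v - w| ^+ 2.
  by apply/RRe_real/ger0_real/exprn_ge0.
have infE : has_inf E.
  split; first by case: V0 => w Vw; exists (complex.Re (`|v - w| ^+ 2)), w.
  by exists 0 => _ [w _ <-]; rewrite -ler0c ReE exprn_ge0.
exists (inf E)%:C => [w Vw|_ /gt0_complexE[r r0 ->]].
  by rewrite -ReE lecR; apply: ge_inf; [case: infE|exists w].
have [_ [w Vw <-] lt_inf] := inf_adherent r0 infE.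
by exists w => //; rewrite -rmorphD/= -ReE ltcR.
Qed.

Lemma closed_subspace_decomposition V v : closed_subspace V ->
  exists2 p, V p & forall u, V u -> dot (v - p) u = 0.
Proof.
move=> [V0 VP Vclosed].
have [d d_le d_lt] := @exists_sqdist V v (ex_intro _ 0 V0).
(* By the parallelogram law, the almost minimizers of the distance from [v] to
   [V] form a Cauchy filter. *)
pose B e := [set w | V w /\ `|v - w| ^+ 2 < d + e].
pose F := filter_from [set e : R[i] | 0 < e] B.
have FF : ProperFilter F.
  apply: filter_from_proper => [|e /d_lt[w Vw ltw]]; last by exists w.
  apply: filter_from_filter; first by exists 1; rewrite /= ltr01.
  move=> _ _ /gt0_complexE[r r0 ->] /gt0_complexE[s s0 ->].
  exists (Num.min r s)%:C; first by rewrite /= ltcR lt_min r0.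
  move=> w [Vw ltw]; split; split=> //; apply: lt_le_trans ltw _;
  by rewrite lerD2l lecR ge_min lexx ?orbT.
have FV : F V by exists 1; [rewrite /= ltr01|move=> w []].
(* The midpoint of [w] and [w'] is in [V], hence at squared distance at least [d] from [v]; the
   parallelogram law then leaves less than [2 (2 d + 2 e) - 4 d]. *)
have sqB e w w' : B e w -> B e w' -> `|w - w'| ^+ 2 < e *+ 4.
  move=> [Vw ltw] [Vw' ltw'].
  have := parallelogram (v - w) (v - w').
  have -> : v - w - (v - w') = w' - w by rewrite opprB addrC addrA subrK.
  have -> : v - w + (v - w') = 2 *: (v - 2^-1 *: (w + w')).
    rewrite scalerBr scalerA mulfV ?pnatr_eq0// scale1r scaler_nat.
    by rewrite opprD addrACA mulr2n.
  rewrite distrC normrZ exprMn => /(canRL (addKr _)) ->.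
  have Vm : V (2^-1 *: (w + w')).
    by rewrite -[X in V X]addr0; apply/VP/V0; rewrite -[w]scale1r; apply/VP.
  have := d_le _ Vm.
  set m := `|_| ^+ 2 => dm.
  rewrite normr_nat -natrX addrC ltrBlDr.
  have lt1 := ltrD ltw ltw'.
  apply: lt_le_trans (_ : (d + e + (d + e)) *+ 2 <= _).
    by rewrite ltr_pMn2r.
  have -> : (d + e + (d + e)) *+ 2 = d *+ 4 + e *+ 4.
    by rewrite addrACA -!mulr2n mulrnDl -!mulrnA.
  by rewrite addrC lerD2l mulr_natl lerMn2r dm orbT.
have Fcauchy : cauchy F.
  apply: cauchy_exP => e e0.
  have e8 : 0 < e ^+ 2 / 4 by rewrite divr_gt0// exprn_gt0.
  have [w Vw ltw] := d_lt _ e8; exists w, (e ^+ 2 / 4) => // w' Bw'.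
  rewrite -ball_normE/=.
  have := sqB _ _ _ (conj Vw ltw) Bw'.
  by rewrite -[_ *+ 4]mulr_natr divfK ?pnatr_eq0// ltr_pXn2r ?nnegrE ?(ltW e0).
have /cvg_ex[p Fp] : cvg F by apply/cauchy_cvgP.
exists p; first exact: (@closed_cvg _ _ F _ id V Vclosed FV).
move=> u Vu.
(* Moving [w] by [a *: u] stays in [V], so it cannot bring the squared distance below [d]: the
   component of [v - w] along [u] is at most [e]. *)
have almost_orth e w : 0 < e -> B (e ^+ 2) w -> `|dot (v - w) u| <= e * `|u|.
  move=> e0 [Vw ltw].
  have [->|u0] := eqVneq u 0; first by rewrite linear0r !normr0 mulr0.
  have [a -> vwE] := orthogonal_split (v - w) u0.
  rewrite normrM normr_id ler_wpM2r//.
  rewrite -(@ler_pXn2r _ 2) ?nnegrE ?(ltW e0)// -(lerD2l d).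
  apply: le_trans (ltW ltw); rewrite vwE lerD2r -addrA -opprD d_le//.
  by rewrite addrC; apply: VP.
(* Choose [w] both almost minimizing and within [c] of [p]; [v - w] and [w - p] each contribute at
   most [c * |u|]. *)
apply: (@small_eq0 _ _ (`|u| *+ 2)) => [|c c0]; first by rewrite mulrn_wge0.
have [e' e'0 Be'] : F (ball p c) by apply/Fp/nbhsx_ballx.
have c2 : 0 < c ^+ 2 by rewrite exprn_gt0.
have [w [Be'w Bcw]] : (B e' `&` B (c ^+ 2)) !=set0.
  apply: (@filter_ex _ F); apply: filterI; first by exists e'.
  by exists (c ^+ 2).
have := Be' _ Be'w; rewrite -ball_normE/= => pw.
rewrite (_ : v - p = (v - w) + (w - p)); last by rewrite addrA subrK.
rewrite linearDl; apply: le_trans (ler_normD _ _) _.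
apply: le_trans (lerD (almost_orth _ _ c0 Bcw) (cauchy_schwarz _ _)) _.
by rewrite mulrnAr mulr2n lerD2l ler_wpM2r// distrC ltW.
Qed.

(** Two candidates differ by a vector of [V] that is orthogonal to itself. *)
Lemma orthogonal_projectionE V v w :
  (forall a u u', V u -> V u' -> V (a *: u + u')) -> V w ->
  (forall u, V u -> dot (v - w) u = 0) ->
  orthogonal_projection dot V v = w.
Proof.
move=> VP Vw w_orth; apply: get_unique; first by split.
move=> w' [Vw' w'_orth].
have Vd : V (w' - w) by rewrite addrC -scaleN1r; apply: VP.
apply/eqP; rewrite -subr_eq0 -(dnorm_eq0 dot).
rewrite {1}(_ : w' - w = (v - w) - (v - w')); last first.
  by rewrite opprB [RHS]addrC addrA subrK.
by rewrite linearBl/= w_orth// w'_orth// subrr.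
Qed.

End Hilbert.

(** * Means over finite sets and unitary representations *)

Section Means.
Variables (C : numFieldType) (H : normedModType C) (G : groupType).
Implicit Types (K L : {fset G}) (f g : G -> H).

Definition mean K f : H := (#|` K|%:R : C)^-1 *: \sum_(t <- K) f t.

Lemma eq_mean K f g : f =1 g -> mean K f = mean K g.
Proof. by move=> fg; congr (_ *: _); apply: eq_bigr. Qed.

Lemma meanP K a f g :
  mean K (fun t => a *: f t + g t) = a *: mean K f + mean K g.
Proof.
rewrite /mean big_split -scaler_sumr scalerDr; congr (_ + _).
by rewrite !scalerA mulrC.
Qed.

Lemma meanB K f g : mean K (fun t => f t - g t) = mean K f - mean K g.
Proof. by rewrite /mean sumrB scalerBr. Qed.

Lemma mean_cst K (u : H) : K != fset0 -> mean K (fun=> u) = u.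
Proof.
rewrite -cardfs_gt0 /mean => K0; rewrite big_const_seq count_predT iter_addr_0.
by rewrite -[u *+ _]scaler_nat scalerA mulVf ?scale1r// pnatr_eq0 -lt0n.
Qed.

Lemma linear_mean (L : {linear H -> H}) K f :
  L (mean K f) = mean K (fun t => L (f t)).
Proof. by rewrite /mean linearZ linear_sum. Qed.

Lemma mean_exchange K L (f : G -> G -> H) :
  mean K (fun s => mean L (f s)) = mean L (fun t => mean K (f^~ t)).
Proof.
rewrite /mean -!scaler_sumr !scalerA mulrC; congr (_ *: _).
exact: exchange_big.
Qed.

Lemma mean_imfset K (h : G -> G) f : injective h ->
  mean [fset h x | x in K]%fset f = mean K (f \o h).
Proof.
move=> hI; rewrite /mean card_imfset//; congr (_ *: _).
by rewrite big_imfset//= => ? ? _ _ /hI.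
Qed.

Lemma norm_sum_le K f c : (forall t, t \in K -> `|f t| <= c) ->
  `|\sum_(t <- K) f t| <= #|` K|%:R * c.
Proof.
move=> fc; apply: le_trans (ler_norm_sum _ _ _) _.
rewrite big_seq_cond; apply: (@le_trans _ _ (\sum_(t <- K) c)).
  rewrite [leRHS]big_seq_cond; apply: ler_sum => t; rewrite andbT; exact: fc.
by rewrite big_const_seq count_predT iter_addr_0 mulr_natl.
Qed.

Lemma norm_mean_le K f c : 0 <= c ->
  (forall t, t \in K -> `|f t| <= c) -> `|mean K f| <= c.
Proof.
move=> c0 fc; rewrite normrZ normfV normr_nat.
have [->|K0] := eqVneq #|` K| 0%N; first by rewrite invr0 mul0r.
by rewrite ler_pdivrMl ?ltr0n ?lt0n// norm_sum_le.
Qed.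

Lemma norm_sum_diff_le K L f c : (forall t, `|f t| <= c) ->
  `|\sum_(t <- K) f t - \sum_(t <- L) f t| <= #|` fsym_diff K L|%:R * c.
Proof.
move=> fc.
have split_sum (A B : {fset G}) : \sum_(t <- A) f t =
    \sum_(t <- (A `&` B)%fset) f t + \sum_(t <- (A `\` B)%fset) f t.
  rewrite (big_fsetID _ (mem B)) /=; congr (_ + _); apply: eq_fbigl => x;
  by rewrite !inE /= // andbC.
have -> : \sum_(t <- K) f t - \sum_(t <- L) f t =
    \sum_(t <- (K `\` L)%fset) f t - \sum_(t <- (L `\` K)%fset) f t.
  by rewrite (split_sum K L) (split_sum L K) fsetIC opprD addrACA subrr add0r.
have -> : #|` fsym_diff K L| = (#|` (K `\` L)%fset| + #|` (L `\` K)%fset|)%N.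
  rewrite -cardfsUI (_ : (_ `&` _)%fset = fset0) ?cardfs0 ?addn0//.
  by apply/fsetP => x; rewrite !inE; case: (x \in K); rewrite ?andbF.
rewrite natrD mulrDl; apply: le_trans (ler_normB _ _) _.
by apply: lerD; apply: norm_sum_le.
Qed.

(** Translating [f] amounts to summing over the translate of [K]; the common part of the two sets
    cancels. *)
Lemma norm_mean_translate_le K f c (x : G) : (forall t, `|f t| <= c) ->
  `|mean K (fun t => f (t * x)%g) - mean K f|
    <= #|` fsym_diff K (rtranslate K x)|%:R / #|` K|%:R * c.
Proof.
move=> fc; rewrite -scalerBr normrZ normfV normr_nat [_ / _]mulrC -mulrA.
rewrite ler_wpM2l ?invr_ge0// distrC.
have -> : \sum_(t <- K) f (t * x)%g = \sum_(t <- rtranslate K x) f t.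
  by rewrite big_imfset//= => ? ? _ _ /mulIg.
exact: norm_sum_diff_le.
Qed.

End Means.

Section UnitaryRepresentation.
Variables (R : realType) (G : groupType) (H : completeNormedModType R[i]).
Variables (dot : {dot H for conjC}) (pi : G -> {linear H -> H}).
Hypotheses (norm_dot : induces_norm dot)
  (unitary_pi : unitary_representation dot pi).
Implicit Types (u v w : H) (s t : G).

Let dot_pi s u v : dot (pi s u) (pi s v) = dot u v.
Proof. by have [/(_ s)[_ ->]] := unitary_pi. Qed.
Let pi1 v : pi 1%g v = v. Proof. by have [_ ->] := unitary_pi. Qed.
Let piM s t v : pi (s * t)%g v = pi s (pi t v).
Proof. by have [_ _ ->] := unitary_pi. Qed.

Lemma norm_pi s v : `|pi s v| = `|v|.
Proof.
by apply/eqP; rewrite -(@eqrXn2 _ 2)// -!norm_dot dot_pi.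
Qed.

Lemma dot_piV s u v : dot (pi s u) v = dot u (pi s^-1%g v).
Proof. by rewrite -[in RHS](dot_pi s) -piM mulgV pi1. Qed.

Lemma dot_mean K v u :
  dot (mean K (fun s => pi s v)) u = dot v (mean K (fun s => pi s^-1%g u)).
Proof.
rewrite /mean linearZl_LR/= linearZr_LR/= fmorphV rmorph_nat.
rewrite (_ : dot (\sum_(t <- K) pi t v) u =
  dot v (\sum_(t <- K) pi t^-1%g u))//.
rewrite linear_sumlz linear_sumr.
by apply: eq_bigr => s _; apply: dot_piV.
Qed.

(** * Null vectors and the subgroup acting trivially modulo them *)

Variable F : nat -> {fset G}.
Hypothesis right_Folner_F : right_Folner R F.

(* Uniformity in [t] stands for the quantification over sequences [t_m]. *)
Definition null_vectors : set H := [set v | forall e, 0 < e ->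
  \forall n \near \oo, forall t, `|mean (F n) (fun s => pi s (pi t v))| <= e].

Local Notation V := null_vectors.

Lemma null_vectorsP a u v : V u -> V v -> V (a *: u + v).
Proof.
move=> Vu Vv e e0.
have a0 : 0 < `|a| + 1 by rewrite ltr_wpDl.
have := Vu (e / 2 / (`|a| + 1)); rewrite !divr_gt0// => /(_ isT) near_u.
have := Vv (e / 2); rewrite !divr_gt0// => /(_ isT) near_v.
near=> n => t.
rewrite (@eq_mean _ _ _ _ _
    (fun s => a *: pi s (pi t u) + pi s (pi t v))); last first.
  by move=> s; rewrite !linearP.
rewrite meanP (splitr e); apply: le_trans (ler_normD _ _) _; apply: lerD.
  rewrite normrZ (@le_trans _ _ ((`|a| + 1) * (e / 2 / (`|a| + 1))))//.
    apply: ler_pM => //; first by rewrite lerDl.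
    by move: t; near: n.
  by rewrite mulrC divfK// gt_eqF.
by move: t; near: n.
Unshelve. all: by end_near. Qed.

Lemma null_vectors0 : V 0.
Proof.
move=> e e0; near=> n => t; rewrite norm_mean_le ?(ltW e0)// => s _.
by rewrite !linear0 normr0 ltW.
Unshelve. all: by end_near. Qed.

(** Means of isometries do not increase the norm, so replacing [v] by a null vector within [e / 2]
    costs at most [e / 2], whatever [n] and [t]. *)
Lemma null_vectors_closed : closed V.
Proof.
move=> v Vv e e0; have e2 : 0 < e / 2 by rewrite divr_gt0.
have [w [Vw]] := Vv _ (nbhsx_ballx v _ e2).
rewrite -ball_normE/= => vw; near=> n => t.
rewrite (splitr e) (@eq_mean _ _ _ _ _
    (fun s => 1 *: pi s (pi t (v - w)) + pi s (pi t w))); last first.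
  by move=> s; rewrite scale1r -!linearD subrK.
rewrite meanP scale1r; apply: le_trans (ler_normD _ _) _; apply: lerD.
  by apply: norm_mean_le => [|s _]; [|rewrite !norm_pi]; apply: ltW.
by move: t; near: n; apply: Vw.
Unshelve. all: by end_near. Qed.

Lemma null_vectors_subspace : closed_subspace V.
Proof.
split; [exact: null_vectors0|exact: null_vectorsP|exact: null_vectors_closed].
Qed.

(** Uniformity in [t] absorbs [x]: [t] is replaced by [t * x]. *)
Lemma null_vectors_pi x v : V v -> V (pi x v).
Proof.
move=> Vv e e0; near=> n => t.
rewrite (@eq_mean _ _ _ _ _ (fun s => pi s (pi (t * x)%g v))); last first.
  by move=> s; rewrite piM.
by move: (t * x)%g; near: n; apply: Vv.
Unshelve. all: by end_near. Qed.

Lemma null_vectorsB u v : V u -> V v -> V (v - u).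
Proof. by move=> Vu Vv; rewrite addrC -scaleN1r; apply: null_vectorsP. Qed.

(** This is the kernel of the action of [G] on the quotient space [H / V]. *)
Definition null_subgroup : set G := [set x | forall u, V (pi x u - u)].

Local Notation N := null_subgroup.

Lemma null_subgroup_subgroup : subgroup N.
Proof.
split=> [u|x y Nx Ny u]; first by rewrite pi1 subrr; apply: null_vectors0.
set w := pi y^-1%g u; have yw : pi y w = u by rewrite -piM mulgV pi1.
have -> : pi (x * y^-1)%g u - u = (pi x w - w) - (pi y w - w).
  by rewrite piM yw opprB addrA subrK.
exact: null_vectorsB.
Qed.

Lemma null_subgroup_normal x y : N x -> N (x ^ y)%g.
Proof.
move=> Nx u; have -> : pi (x ^ y)%g u - u = pi y^-1%g (pi x (pi y u) - pi y u).
  by rewrite linearB -!piM conjgE mulVg pi1.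
exact/null_vectors_pi.
Qed.

Definition orthogonal_to_null u := forall w, V w -> dot u w = 0.

Lemma orthogonal_to_null_pi s u :
  orthogonal_to_null u -> orthogonal_to_null (pi s u).
Proof. by move=> uV w Vw; rewrite dot_piV; apply/uV/null_vectors_pi. Qed.

(** The vector [pi s u - u] lies in [V] and is orthogonal to [V], hence to itself. *)
Lemma null_subgroup_fix s u : N s -> orthogonal_to_null u -> pi s u = u.
Proof.
move=> Ns uV; apply/eqP; rewrite -subr_eq0 -normr_eq0 -sqrf_eq0 -norm_dot.
by rewrite linearBl/= orthogonal_to_null_pi// uV// subrr.
Qed.

Lemma right_Folner_le x (e : R[i]) : 0 < e -> \forall n \near \oo,
  #|` fsym_diff (F n) (rtranslate (F n) x)|%:R / #|` F n|%:R <= e.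
Proof.
move=> /gt0_complexE[r r0 ->].
have [_ /(_ x)/cvgr_dist_le/(_ r r0)] := right_Folner_F.
apply: filterS => n; rewrite sub0r normrN ger0_norm ?divr_ge0//.
by rewrite -lecR fmorph_div !rmorph_nat.
Qed.

Lemma null_subgroup_finite_class x :
  (exists cs : seq G, forall y,
    exists2 c, c \in cs & N ((x ^ y) * c^-1)%g) -> N x.
Proof.
move=> [cs csP] u.
have [p Vp qV] :=
  closed_subspace_decomposition norm_dot u null_vectors_subspace.
set q := u - p in qV.
have -> : pi x u - u = 1 *: (pi x p - p) + (pi x q - q).
  by rewrite scale1r /q linearB addrACA -opprD ![_ + (_ - _)]addrC !subrK.
apply: null_vectorsP; first exact/null_vectorsB/null_vectors_pi.
move=> e e0; have q1 : 0 < `|q| + 1 by rewrite ltr_wpDl.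
(* As [cs] is finite, one rank serves all its elements, hence all [t]. The [+ 1] allows for
   [q = 0]. *)
have near_cs : \forall n \near \oo, forall c, c \in cs ->
    #|` fsym_diff (F n) (rtranslate (F n) c)|%:R / #|` F n|%:R
      <= e / (`|q| + 1).
  elim: (cs) => [|c cs' IH]; first by near=> n.
  have e1 : 0 < e / (`|q| + 1) by rewrite divr_gt0.
  near=> n => c'; rewrite inE => /orP[/eqP ->|]; last first.
    by move: c'; near: n.
  by near: n; apply: right_Folner_le.
near=> n => t.
have [c ccs Nc] := csP t^-1%g.
(* The factor [(x ^ t^-1) * c^-1] is in [N] and so fixes the orbit of [q]. *)
have txE : (t * x = (x ^ t^-1) * c^-1 * (c * t))%g.
  by rewrite mulgA mulgVK conjgE invgK -!mulgA mulVg mulg1.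
have pitx : pi t (pi x q) = pi c (pi t q).
  rewrite -piM txE piM (null_subgroup_fix Nc) ?piM//.
  by do 2 apply: orthogonal_to_null_pi.
rewrite (@eq_mean _ _ _ _ _
    (fun s => pi (s * c)%g (pi t q) - pi s (pi t q))); last first.
  by move=> s; rewrite (linearB (pi t)) (linearB (pi s))/= piM pitx.
rewrite meanB.
have pi_le s : `|pi s (pi t q)| <= `|q| by rewrite !norm_pi.
apply: le_trans (norm_mean_translate_le _ _ pi_le) _.
apply: (@le_trans _ _ (e / (`|q| + 1) * (`|q| + 1))).
  apply: ler_pM => //; last by rewrite lerDl.
  by move: c ccs {Nc txE pitx}; near: n.
by rewrite divfK// gt_eqF.
Unshelve. all: by end_near. Qed.

Lemma null_invariant_decomposition v : ~ admits_ICC_quotient G ->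
  exists2 p, V p & invariant_vectors pi (v - p) /\ P_inv dot pi v = v - p.
Proof.
move=> noICC.
have NT : forall x, N x.
  apply: no_ICC_quotient_full => //.
  - exact: null_subgroup_subgroup.
  - exact: null_subgroup_normal.
  - exact: null_subgroup_finite_class.
have [p Vp qV] :=
  closed_subspace_decomposition norm_dot v null_vectors_subspace.
have q_inv : invariant_vectors pi (v - p).
  by move=> s; apply: null_subgroup_fix.
exists p => //; split=> //; apply: orthogonal_projectionE => //.
  by move=> a u u' u_inv u'_inv s; rewrite linearP u_inv u'_inv.
(* It remains to see that [p] is orthogonal to invariant vectors: the adjoint of a mean fixes [u],
   so [p] may be replaced by its means, which are small. *)
move=> u u_inv; rewrite opprB addrC subrK.
apply: (@small_eq0 _ _ `|u|) => // e e0.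
have [n _ /(_ n (leqnn n) 1%g) mean_le] := Vp e e0.
have -> : dot p u = dot (mean (F n) (fun s => pi s (pi 1%g p))) u.
  rewrite dot_mean pi1 (@eq_mean _ _ _ _ _ (fun=> u)); last first.
    by move=> s; apply: u_inv.
  by rewrite mean_cst//; have [+ _] := right_Folner_F.
apply: le_trans (cauchy_schwarz norm_dot _ _) _.
by rewrite ler_wpM2r.
Qed.

End UnitaryRepresentation.

(** * Convergence of means along right and left Folner sequences *)

Lemma right_Folner_firm_strong (R : realType) (G : groupType)
    (F : nat -> {fset G}) :
  ~ admits_ICC_quotient G -> right_Folner R F -> firm_strong R F.
Proof.
move=> noICC FF H dot pi norm_dot upi t_ v.
have [p Vp [q_inv ->]] := null_invariant_decomposition norm_dot upi FF v noICC.
apply/cvgrPdist_le => e e0; near=> n.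
rewrite -[X in `|_ - X|]/(mean (F n) (fun t => pi (t * t_ n)%g v)).
(* The invariant part [v - p] has constant mean, the limit; the mean of the rest is small uniformly
   in [t_ n]. *)
rewrite (@eq_mean _ _ _ _ _
    (fun s => 1 *: pi s (pi (t_ n) p) + (v - p))); last first.
  move=> s; have [_ _ piM] := upi.
  by rewrite -(q_inv (s * t_ n)%g) scale1r -!piM -linearD addrC subrK.
rewrite meanP mean_cst; last by have [+ _] := FF.
rewrite scale1r opprD addrCA subrr addr0 normrN.
by move: (t_ n); near: n; apply: Vp.
Unshelve. all: by end_near. Qed.

(** Inversion turns left translation by [t^-1] into right translation by [t] and preserves
    cardinals. *)
Lemma left_Folner_invg (R : realType) (G : groupType) (F : nat -> {fset G}) :
  left_Folner R F -> right_Folner R (fun n => [fset x^-1%g | x in F n]%fset).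
Proof.
move=> [F0 Flim]; split=> [n|t].
  by rewrite -cardfs_gt0 card_imfset ?cardfs_gt0//; apply: invg_inj.
have := Flim t^-1%g; apply: cvg_trans; apply: near_eq_cvg; near=> n.
have invF (A : {fset G}) x :
    (x \in [fset x^-1 | x in A]%g%fset) = (x^-1%g \in A).
  by rewrite -{1}[x]invgK (mem_imfset _ _ (@invg_inj G)).
have rtE (A : {fset G}) x y : (x \in rtranslate A y) = ((x * y^-1)%g \in A).
  by rewrite -{1}[x](mulgVK y) (mem_imfset _ _ (@mulIg G y)).
have ltE (A : {fset G}) x y : (x \in ltranslate y A) = ((y^-1 * x)%g \in A).
  by rewrite -{1}[x](mulVKg y) (mem_imfset _ _ (@mulgI G y)).
have cardV (A : {fset G}) : #|` [fset x^-1 | x in A]%g%fset| = #|` A|.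
  by rewrite card_imfset//; apply: invg_inj.
rewrite cardV -[X in X%:R / _ = _]cardV; congr (#|` _|%:R / _).
by apply/fsetP => x; rewrite invF !inE !rtE !ltE !invF invgM !invgK.
Unshelve. all: by end_near. Qed.

Lemma no_ICC_quotient_left_strong_ergodic (R : realType) (G : groupType) :
  ~ admits_ICC_quotient G -> left_strong_ergodic_theorem R G.
Proof.
move=> noICC H dot pi norm_dot upi F FF v.
have [p Vp [q_inv ->]] :=
  null_invariant_decomposition norm_dot upi (left_Folner_invg FF) v noICC.
apply/cvgrPdist_le => e e0.
have p1 : 0 < `|p| + 1 by rewrite ltr_wpDl.
(* Cauchy-Schwarz will bound the square of the mean of [p] by [|p|] times this quantity, hence by
   [e ^+ 2]. *)
have e'0 : 0 < e ^+ 2 / (`|p| + 1) by rewrite divr_gt0 ?exprn_gt0.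
have near_p := Vp _ e'0.
near=> n.
rewrite -[X in `|_ - X|]/(mean (F n) (fun s => pi s v)).
rewrite (@eq_mean _ _ _ _ _ (fun s => 1 *: pi s p + (v - p))); last first.
  by move=> s; rewrite -(q_inv s) scale1r -linearD addrC subrK.
rewrite meanP mean_cst; last by have [+ _] := FF.
rewrite scale1r opprD addrCA subrr addr0 normrN.
set B := mean _ _.
(* Taking adjoints turns the mean over [F n] into the one over its inverse. *)
rewrite -(@ler_pXn2r _ 2) ?nnegrE ?(ltW e0)//.
have BB : `|B| ^+ 2 = `|dot p (mean (F n) (fun s => pi s^-1%g B))|.
  by rewrite -(dot_mean upi) norm_dot ger0_norm ?exprn_ge0.
rewrite BB; apply: le_trans (cauchy_schwarz norm_dot _ _) _.
apply: (@le_trans _ _ ((`|p| + 1) * (e ^+ 2 / (`|p| + 1)))); last first.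
  by rewrite mulrC divfK// gt_eqF.
apply: ler_pM => //; first by rewrite lerDl.
have -> : mean (F n) (fun s => pi s^-1%g B) =
    mean (F n) (fun r =>
      mean [fset x^-1%g | x in F n]%fset (fun s => pi s (pi r p))).
  rewrite mean_exchange mean_imfset; last exact: invg_inj.
  by apply: eq_mean => s; rewrite linear_mean.
apply: norm_mean_le => [|r _]; first exact: ltW.
by move: r; near: n.
Unshelve. all: by end_near. Qed.

Theorem theorem1p3 (R : realType) :
  (forall G : groupType,
     countable [set: G]%classic -> amenable R G -> ~ admits_ICC_quotient G ->
     forall F : nat -> {fset G}, right_Folner R F -> firm_strong R F)
  /\
  (forall G : groupType,
     countable [set: G]%classic -> virtually_nilpotent G ->
     left_strong_ergodic_theorem R G).
Proof.
split=> [G _ _ noICC F|G _ vnG]; first exact: right_Folner_firm_strong.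
exact/no_ICC_quotient_left_strong_ergodic/virtually_nilpotent_no_ICC_quotient.
Qed.
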